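(* The adjunction $\mathcal O\dashv \mathrm{pt}$ between topological spaces and locales restricts to an adjoint equivalence between the category of LCS-complete spaces (resp. domain-complete spaces) with continuous maps and the opposite of the category (with frame homomorphisms) of quotient frames $L/{\preceq_A}$, where $L$ is a distributive continuous complete lattice (resp. a completely distributive complete lattice which is continuous) and $A$ is a countable subset of $L$.
   Context: $\mathcal O$ sends a space $X$ to its frame of open sets and a continuous $f$ to $U\mapsto f^{-1}(U)$; $\mathrm{pt}$ sends a frame $L$ to the set of completely prime filters of $L$ with open sets $\{x\mid u\in x\}$, $u\in L$. A congruence preorder on a frame $L$ is a transitive relation $\preceq$ with $u\le v\Rightarrow u\preceq v$, $\bigvee_i u_i\preceq v$ whenever all $u_i\preceq v$, and $u\preceq \bigwedge_{i=1}^n v_i$ whenever $u\preceq v_i$ for all $i\le n$; the quotient frame $L/{\preceq}$ consists of equivalence classes modulo $\preceq\cap\succeq$. For $A\subseteq L$, $\preceq_A$ is the least congruence preorder with $\top\preceq_A a$ for all $a\in A$. A space is domain-complete (resp. LCS-complete) if it is homeomorphic to a $G_\delta$ subset (countable intersection of open sets), with the subspace topology, of some continuous dcpo with its Scott topology (resp. of some locally compact sober space, locally compact meaning every point has a neighborhood base of compact saturated sets). *)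

(* Defs.v *)
From Stdlib Require Import List.

(* Raw structures.  Sets are predicates.                               *)
(* A "space" is a carrier with a family of open sets; being a          *)
(* topological space is the predicate [is_topology].                   *)
(* A "poset" is a carrier with a relation; frames / complete lattices  *)
(* are described order-theoretically (joins = least upper bounds,      *)
(* meets = greatest lower bounds), up to the induced equivalence.      *)

Record Space := { pts : Type ; opn : (pts -> Prop) -> Prop }.
Record Poset := { car : Type ; le : car -> car -> Prop }.

Arguments opn {s} _.
Arguments le {p} _ _.

Section Order.
Variable P : Poset.

Definition is_ub (S : car P -> Prop) (x : car P) := forall y, S y -> le y x.
Definition is_lub (S : car P -> Prop) (x : car P) :=
  is_ub S x /\ forall z, is_ub S z -> le x z.
Definition is_lb (S : car P -> Prop) (x : car P) := forall y, S y -> le x y.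
Definition is_glb (S : car P -> Prop) (x : car P) :=
  is_lb S x /\ forall z, is_lb S z -> le z x.
Definition is_top (t : car P) := forall y, le y t.
Definition pequiv (x y : car P) := le x y /\ le y x.
Definition pair2 (a b : car P) : car P -> Prop := fun z => z = a \/ z = b.

Definition is_partial_order :=
  (forall x : car P, le x x) /\ (forall x y z : car P, le x y -> le y z -> le x z) /\
  (forall x y : car P, le x y -> le y x -> x = y).

Definition directed (D : car P -> Prop) :=
  (exists d, D d) /\
  forall x y : car P, D x -> D y -> exists z, D z /\ le x z /\ le y z.

Definition is_complete_lattice :=
  is_partial_order /\ forall S : car P -> Prop, exists s, is_lub S s.

Definition is_dcpo :=
  is_partial_order /\ forall D, directed D -> exists s, is_lub D s.

Definition way_below (x y : car P) :=
  forall D s, directed D -> is_lub D s -> le y s -> exists d, D d /\ le x d.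

Definition is_continuous :=
  forall y, directed (fun x => way_below x y) /\ is_lub (fun x => way_below x y) y.

Definition is_distributive :=
  forall x y z yz m xy xz k,
    is_lub (pair2 y z) yz -> is_glb (pair2 x yz) m ->
    is_glb (pair2 x y) xy -> is_glb (pair2 x z) xz ->
    is_lub (pair2 xy xz) k -> m = k.

Definition is_completely_distributive :=
  forall (I : Type) (S : I -> car P -> Prop) (a : I -> car P) (m : car P),
    (forall i, is_lub (S i) (a i)) ->
    is_glb (fun y => exists i, y = a i) m ->
    is_lub (fun y => exists f : I -> car P,
                       (forall i, S i (f i)) /\ is_glb (fun z => exists i, z = f i) y) m.

Definition is_cpf (F : car P -> Prop) :=
  (forall x y : car P, le x y -> F x -> F y) /\
  (exists t, is_top t /\ F t) /\
  (forall x y m, is_glb (pair2 x y) m -> F x -> F y -> F m) /\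
  (forall S s, is_lub S s -> F s -> exists x, S x /\ F x).

Definition is_congruence_preorder (R : car P -> car P -> Prop) :=
  (forall x y z : car P, R x y -> R y z -> R x z) /\
  (forall u v : car P, le u v -> R u v) /\
  (forall S s v, is_lub S s -> (forall u, S u -> R u v) -> R s v) /\
  (forall u (l : list (car P)) m, is_glb (fun x => In x l) m ->
      (forall v, In v l -> R u v) -> R u m).

Definition preceq_A (A : car P -> Prop) (u v : car P) :=
  forall R, is_congruence_preorder R ->
    (forall a t, A a -> is_top t -> R t a) -> R u v.

Definition countable (A : car P -> Prop) :=
  exists g : car P -> nat, forall a b, A a -> A b -> g a = g b -> a = b.

End Order.

(* the quotient frame L / preceq_A, as the carrier of L with the order preceq_A
   (elements are representatives of equivalence classes modulo preceq_A /\ succeq_A) *)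
Definition quot (L : Poset) (A : car L -> Prop) : Poset :=
  {| car := car L ; le := preceq_A L A |}.

Definition frame_hom (F G : Poset) (f : car F -> car G) :=
  (forall S s, is_lub F S s -> is_lub G (fun y => exists x, S x /\ y = f x) (f s)) /\
  (forall (l : list (car F)) m, is_glb F (fun x => In x l) m ->
       is_glb G (fun y => In y (map f l)) (f m)).

Definition frame_iso_map (F G : Poset) (f : car F -> car G) :=
  frame_hom F G f /\
  exists g : car G -> car F, frame_hom G F g /\
    (forall a, pequiv F (g (f a)) a) /\ (forall b, pequiv G (f (g b)) b).

Definition frame_iso (F G : Poset) := exists f, frame_iso_map F G f.

Definition is_topology (X : Space) :=
  (forall U V : pts X -> Prop, (forall x, U x <-> V x) -> opn U -> opn V) /\
  opn (fun _ : pts X => True) /\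
  (forall U V : pts X -> Prop, opn U -> opn V -> opn (fun x => U x /\ V x)) /\
  (forall F : (pts X -> Prop) -> Prop, (forall U, F U -> opn U) ->
      opn (fun x => exists U, F U /\ U x)).

Definition continuous (X Y : Space) (f : pts X -> pts Y) :=
  forall V, opn V -> opn (fun x => V (f x)).

Definition is_homeo (X Y : Space) (f : pts X -> pts Y) :=
  continuous X Y f /\
  exists g : pts Y -> pts X, continuous Y X g /\
    (forall x, g (f x) = x) /\ (forall y, f (g y) = y).

Definition homeomorphic (X Y : Space) := exists f, is_homeo X Y f.

Definition subspace (Y : Space) (G : pts Y -> Prop) : Space :=
  {| pts := { y : pts Y | G y } ;
     opn := fun V => exists U, opn U /\ forall p, V p <-> U (proj1_sig p) |}.

Definition G_delta (Y : Space) (G : pts Y -> Prop) :=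
  exists U : nat -> pts Y -> Prop, (forall n, opn (U n)) /\
    forall y, G y <-> forall n, U n y.

Definition compact (X : Space) (K : pts X -> Prop) :=
  forall F : (pts X -> Prop) -> Prop, (forall U, F U -> opn U) ->
    (forall x, K x -> exists U, F U /\ U x) ->
    exists l : list (pts X -> Prop), (forall U, In U l -> F U) /\
      forall x, K x -> exists U, In U l /\ U x.

Definition saturated (X : Space) (K : pts X -> Prop) :=
  forall x, (forall U, opn U -> (forall y, K y -> U y) -> U x) -> K x.

Definition locally_compact (X : Space) :=
  forall x U, opn U -> U x ->
    exists K V, compact X K /\ saturated X K /\ opn V /\ V x /\
      (forall y, V y -> K y) /\ (forall y, K y -> U y).

Definition O (X : Space) : Poset :=
  {| car := { U : pts X -> Prop | opn U } ;
     le := fun U V => forall x, proj1_sig U x -> proj1_sig V x |}.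

Definition pt (L : Poset) : Space :=
  {| pts := { F : car L -> Prop | is_cpf L F } ;
     opn := fun V => exists u, forall p, V p <-> proj1_sig p u |}.

Definition sober (X : Space) :=
  forall P : car (O X) -> Prop, is_cpf (O X) P ->
    exists! x, forall U, P U <-> proj1_sig U x.

Definition scott (D : Poset) : Space :=
  {| pts := car D ;
     opn := fun U => (forall x y : car D, le x y -> U x -> U y) /\
                     (forall S s, directed D S -> is_lub D S s -> U s ->
                        exists d, S d /\ U d) |}.

Definition LCS_complete (X : Space) :=
  exists Y : Space, is_topology Y /\ sober Y /\ locally_compact Y /\
    exists G, G_delta Y G /\ homeomorphic X (subspace Y G).

Definition domain_complete (X : Space) :=
  exists D : Poset, is_dcpo D /\ is_continuous D /\
    exists G, G_delta (scott D) G /\ homeomorphic X (subspace (scott D) G).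

Definition unit_iso (X : Space) :=
  exists h : pts X -> pts (pt (O X)),
    (forall x U, proj1_sig (h x) U <-> proj1_sig U x) /\ is_homeo X (pt (O X)) h.

Definition eps (L : Poset) (u : car L) : car (O (pt L)) :=
  exist (fun V : pts (pt L) -> Prop => opn V)
        (fun p : pts (pt L) => proj1_sig p u)
        (ex_intro _ u (fun p => iff_refl _)).

Definition counit_iso (L : Poset) := frame_iso_map L (O (pt L)) (eps L).

Definition dist_cont_clat (L : Poset) :=
  is_complete_lattice L /\ is_distributive L /\ is_continuous L.

Definition cd_cont_clat (L : Poset) :=
  is_complete_lattice L /\ is_completely_distributive L /\ is_continuous L.

(* Main.v *)
(** A point of L/≼_A is a completely prime filter of L containing A.  If L is a
    distributive continuous lattice and A = {a_0, a_1, ...}, these points separate: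
    when u ⋠_A v, one builds a chain u = u_0, u_{n+1} ≪ u_n ∧ a_n with u_n ⋠_A v;
    its up-closure is a Scott-open filter missing v, and a maximal element outside it
    above v is prime, hence yields a point.  So L/≼_A is spatial, and its space of
    points is the G_δ set of points of L containing A, where pt L is locally compact
    sober (Hofmann–Lawson).  Conversely, for a G_δ set X = ⋂ U_n in a locally compact
    sober space Y, O(X) is the quotient of O(Y) by {U_n}, again by separation.

    In the domain case, O of a continuous dcpo is completely distributive, and if L is
    completely distributive then pt L is the Scott space of the completely prime filters
    of L under inclusion; that this dcpo is continuous follows from Raney's
    totally-below relation, whose interpolating chains generate completely prime
    filters. *)
From Stdlib Require Import List Arith.
From mathcomp Require boolp classical_sets.
Require Import Defs.

Set Bullet Behavior "Strict Subproofs".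

(** * Dependent choice and extensionality *)

Lemma dependent_choice (T : Type) (P : T -> Prop) (Q : nat -> T -> T -> Prop) (x0 : T) :
  P x0 -> (forall n x, P x -> exists y, P y /\ Q n x y) ->
  exists s : nat -> T, s 0 = x0 /\ forall n, P (s n) /\ Q n (s n) (s (S n)).
Proof.
  intros H0 H.
  (* Pairing each element with its stage reduces a stage-dependent relation to a single choice
     function. *)
  assert (C : forall nx : nat * {x | P x}, exists y : {x | P x},
             Q (fst nx) (proj1_sig (snd nx)) (proj1_sig y)).
  { intros [n [x Hx]]. destruct (H n x Hx) as [y [Hy HQ]].
    exists (exist _ y Hy). exact HQ. }
  destruct (boolp.choice C) as [f Hf].
  set (s := nat_rect (fun _ => {x | P x}) (exist _ x0 H0) (fun n x => f (n, x))).
  exists (fun n => proj1_sig (s n)). split; [reflexivity|].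
  intros n. split; [exact (proj2_sig (s n))|]. exact (Hf (n, s n)).
Qed.

Lemma pred_ext (T : Type) (U V : T -> Prop) : (forall x, U x <-> V x) -> U = V.
Proof. intros H. apply boolp.funext. intros x. apply boolp.propext, H. Qed.

Lemma sig_ext (T : Type) (P : T -> Prop) (p q : {x | P x}) :
  proj1_sig p = proj1_sig q -> p = q.
Proof. destruct p, q. simpl. intros H. apply boolp.eq_exist, H. Qed.

Lemma glb_ext (P : Poset) (S S' : car P -> Prop) (m : car P) :
  (forall x, S x <-> S' x) -> is_glb P S m -> is_glb P S' m.
Proof. intros H. rewrite (pred_ext _ _ _ H). auto. Qed.

(** * Scott-open filters in complete lattices *)

Section CompleteLattice.
Variable L : Poset.
Hypothesis HL : is_complete_lattice L.

Lemma clat_refl (x : car L) : le x x.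
Proof. apply HL. Qed.

Lemma clat_trans (x y z : car L) : le x y -> le y z -> le x z.
Proof. apply HL. Qed.

Lemma clat_glb (S : car L -> Prop) : exists m, is_glb L S m.
Proof.
  destruct (proj2 HL (is_lb L S)) as [m [Hu Hl]]. exists m. split.
  - intros y Hy. apply Hl. intros z Hz. apply Hz, Hy.
  - intros z Hz. apply Hu, Hz.
Qed.

Lemma clat_top : exists t, is_top L t.
Proof.
  destruct (proj2 HL (fun _ => True)) as [t [Ht _]]. exists t. intros y. apply Ht. exact I.
Qed.

Lemma way_below_le (x y : car L) : way_below L x y -> le x y.
Proof.
  intros H. destruct (H (eq y) y) as [d [<- Hd]]; auto using clat_refl.
  - split; [exists y; reflexivity|]. intros a b <- <-. exists y. auto using clat_refl.
  - split; [intros z <-; apply clat_refl|]. intros z Hz. apply Hz. reflexivity.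
Qed.

Lemma way_below_directed (y : car L) : directed L (fun x => way_below L x y).
Proof.
  split.
  - destruct (proj2 HL (fun _ => False)) as [b [_ Hb]]. exists b.
    intros D s [[d Hd] _] _ _. exists d. split; [exact Hd|]. apply Hb. intros z [].
  - intros u v Hu Hv. destruct (proj2 HL (pair2 L u v)) as [j [Hj1 Hj2]].
    exists j. split; [|split; apply Hj1; [left|right]; reflexivity].
    intros D s HD Hs Hy.
    destruct (Hu D s HD Hs Hy) as [d [Dd Hd]]. destruct (Hv D s HD Hs Hy) as [e [De He]].
    destruct (proj2 HD d e Dd De) as [c [Dc [Hc1 Hc2]]].
    exists c. split; [exact Dc|]. apply Hj2.
    intros z [-> | ->]; eapply clat_trans; eauto.
Qed.

Definition scott_open_filter (Phi : car L -> Prop) :=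
  (forall x y : car L, le x y -> Phi x -> Phi y) /\
  (exists x, Phi x) /\
  (forall x y m, is_glb L (pair2 L x y) m -> Phi x -> Phi y -> Phi m) /\
  (forall D s, directed L D -> is_lub L D s -> Phi s -> exists d, D d /\ Phi d).

Lemma chain_antitone (s : nat -> car L) : (forall n, le (s (S n)) (s n)) ->
  forall n k, n <= k -> le (s k) (s n).
Proof.
  intros Hs n k H. induction H; [apply clat_refl|]. eapply clat_trans; eauto.
Qed.

Lemma chain_filter_meet (s : nat -> car L) : (forall n, le (s (S n)) (s n)) ->
  forall x y m, is_glb L (pair2 L x y) m ->
  (exists n, le (s n) x) -> (exists n, le (s n) y) -> exists n, le (s n) m.
Proof.
  intros Hs x y m [_ Hm] [n Hn] [k Hk]. exists (max n k). apply Hm.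
  intros z [-> | ->]; eapply clat_trans; eauto; apply chain_antitone; auto.
  - apply Nat.le_max_l.
  - apply Nat.le_max_r.
Qed.

(** If [s n] lies below a directed join, [s (S n)] lies below a member of the directed set; this
    gives Scott-openness. *)
Lemma way_below_chain_filter (s : nat -> car L) :
  (forall n, way_below L (s (S n)) (s n)) ->
  scott_open_filter (fun w => exists n, le (s n) w).
Proof.
  intros Hs. split; [|split; [|split]].
  - intros x y Hxy [n Hn]. exists n. eapply clat_trans; eauto.
  - exists (s 0), 0. apply clat_refl.
  - apply chain_filter_meet. intros n. apply way_below_le, Hs.
  - intros D t HD Ht [n Hn]. destruct (Hs n D t HD Ht Hn) as [d [Dd Hd]].
    exists d. eauto.
Qed.

(** Scott-openness makes the complement of [Phi] closed under directed joins, so Zorn's lemma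
    applies to the elements above [v] outside [Phi]. *)
Lemma exists_maximal_avoiding (Phi : car L -> Prop) (v : car L) :
  scott_open_filter Phi -> ~ Phi v ->
  exists p, le v p /\ ~ Phi p /\ forall q, le p q -> ~ Phi q -> q = p.
Proof.
  intros [_ [_ [_ HPo]]] Hv.
  set (T := {x : car L | le v x /\ ~ Phi x}).
  set (R := fun x y : T => boolp.asbool (le (proj1_sig x) (proj1_sig y))).
  assert (RE : forall x y : T,
             is_true (R x y) <-> le (proj1_sig x) (proj1_sig y)).
  { intros x y. unfold R. split.
    - apply boolp.asboolW.
    - apply boolp.asboolT. }
  destruct (@classical_sets.Zorn T R) as [[p [Hvp HPp]] Hp].
  - intros t. apply RE, clat_refl.
  - intros r s t. rewrite !RE. apply clat_trans.
  - intros s t. rewrite !RE. intros H1 H2. apply sig_ext. apply HL; assumption.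
  - intros A HA. destruct (boolp.EM (exists a, A a)) as [[a Aa] | HN].
    + set (D := fun x => exists t : T, A t /\ proj1_sig t = x).
      destruct (proj2 HL D) as [j Hj].
      assert (Hvj : le v j).
      { apply clat_trans with (proj1_sig a); [apply (proj2_sig a)|].
        apply Hj. exists a. auto. }
      assert (HPj : ~ Phi j).
      { intros Pj. destruct (HPo D j) as [d [[t [At <-]] Pd]]; auto.
        - split; [exists (proj1_sig a), a; auto|].
          intros x y [t [At <-]] [t' [At' <-]].
          destruct (HA t t' At At') as [H | H]; apply RE in H.
          + exists (proj1_sig t'). split; [exists t'; auto|]. auto using clat_refl.
          + exists (proj1_sig t). split; [exists t; auto|]. auto using clat_refl.
        - apply (proj2_sig t), Pd. }
      exists (exist _ j (conj Hvj HPj)). intros t At. apply RE. simpl.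
      apply Hj. exists t. auto.
    (* The empty chain is bounded by [v] itself. *)
    + exists (exist _ v (conj (clat_refl v) Hv)). intros t At. exfalso. eauto.
  - exists p. split; [exact Hvp|]. split; [exact HPp|]. intros q Hpq HPq.
    assert (Hvq : le v q) by (eapply clat_trans; eauto).
    specialize (Hp (exist _ q (conj Hvq HPq))). rewrite RE in Hp.
    apply Hp in Hpq. now inversion Hpq.
Qed.

(* A maximal element outside the filter is prime by distributivity, and the
   elements not below a prime form a completely prime filter. *)
Lemma scott_open_filter_separation (Phi : car L -> Prop) (v : car L) :
  is_distributive L -> scott_open_filter Phi -> ~ Phi v ->
  exists F, is_cpf L F /\ (forall w, Phi w -> F w) /\ ~ F v.
Proof.
  intros Hdist HPhi Hv.
  destruct (exists_maximal_avoiding Phi v HPhi Hv) as [p [Hvp [HPp Hmax]]].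
  destruct HPhi as [HPu [[w0 Hw0] [HPm _]]].
  assert (Hin : forall w, Phi w -> ~ le w p) by (intros w Hw H; eauto).
  exists (fun w => ~ le w p). split; [|split]; auto.
  split; [|split; [|split]].
  - intros x y Hxy Hx Hy. apply Hx. eapply clat_trans; eauto.
  - destruct clat_top as [t Ht]. exists t. split; [exact Ht|].
    apply Hin. apply HPu with w0; auto.
  - intros x y m Hm Hx Hy Hmp.
    (* By maximality of [p], its join with any element not below it lies in [Phi]; this applies to
       [x] and to [y]. *)
    assert (Hjoin : forall z j, is_lub L (pair2 L p z) j -> ~ le z p -> Phi j).
    { intros z j Hj Hz. apply boolp.contrapT. intros HPj. apply Hz.
      rewrite <- (Hmax j) by (auto; apply Hj; left; reflexivity).
      apply Hj. right. reflexivity. }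
    destruct (proj2 HL (pair2 L p x)) as [px Hpx].
    destruct (proj2 HL (pair2 L p y)) as [py Hpy].
    destruct (clat_glb (pair2 L px py)) as [k Hk].
    destruct (clat_glb (pair2 L px p)) as [a Ha].
    destruct (clat_glb (pair2 L px y)) as [b Hb].
    destruct (proj2 HL (pair2 L a b)) as [ab Hab].
    (* Distributing twice writes [k], the meet of the two joins, as a join of elements that are
       below [p] or below the meet [m] of [x] and [y], hence all below [p]. *)
    assert (Ek : k = ab) by exact (Hdist _ _ _ _ _ _ _ _ Hpy Hk Ha Hb Hab).
    destruct (clat_glb (pair2 L y p)) as [c Hc].
    destruct (clat_glb (pair2 L y x)) as [d Hd].
    destruct (proj2 HL (pair2 L c d)) as [cd Hcd].
    assert (Eb : b = cd).
    { apply (fun H => Hdist _ _ _ _ _ _ _ _ Hpx H Hc Hd Hcd). eapply glb_ext; [|exact Hb].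
      intros z. unfold pair2. tauto. }
    assert (Hkp : le k p).
    { rewrite Ek. apply Hab. intros z [-> | ->].
      - apply Ha. right. reflexivity.
      - rewrite Eb. apply Hcd. intros z [-> | ->].
        + apply Hc. right. reflexivity.
        + apply clat_trans with m; [|exact Hmp]. apply Hm.
          intros z [-> | ->]; apply Hd; [right|left]; reflexivity. }
    apply HPp, (HPu k); [exact Hkp|]. eapply HPm; eauto.
  - intros S s Hs Hsp. apply boolp.contrapT. intros HN. apply Hsp, Hs.
    intros x Sx. apply boolp.contrapT. intros Hx. apply HN. eauto.
Qed.

End CompleteLattice.

(** * Interpolation and descending chains *)

(** The elements [a] with [a] ≪ [b] ≪ [y] for some [b] form a directed set with join [y]; testing
    [x] ≪ [y] on it yields the interpolant [b]. *)
Lemma way_below_interpolation (P : Poset) : is_partial_order P -> is_continuous P ->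
  forall x y, way_below P x y -> exists m, way_below P x m /\ way_below P m y.
Proof.
  intros [Hr [Ht Ha]] Hc x y Hxy.
  assert (Hle : forall a b, way_below P a b -> le a b).
  { intros a b H. apply (proj2 (Hc b)). exact H. }
  assert (Hl : forall a b c, le a b -> way_below P b c -> way_below P a c).
  { intros a b c Hab Hbc D s HD Hs H. destruct (Hbc D s HD Hs H) as [d [Dd Hd]].
    exists d. eauto. }
  assert (Hrr : forall a b c, way_below P a b -> le b c -> way_below P a c).
  { intros a b c Hab Hbc D s HD Hs H. apply (Hab D s HD Hs). eauto. }
  destruct (Hxy (fun a => exists b, way_below P a b /\ way_below P b y) y)
    as [d [[b [Hdb Hby]] Hxd]].
  - split.
    + destruct (proj1 (proj1 (Hc y))) as [b Hb].
      destruct (proj1 (proj1 (Hc b))) as [a Hab]. eauto.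
    + intros a1 a2 [b1 [Ha1 Hb1]] [b2 [Ha2 Hb2]].
      destruct (proj2 (proj1 (Hc y)) b1 b2 Hb1 Hb2) as [b [Hb [H1 H2]]].
      destruct (proj2 (proj1 (Hc b)) a1 a2) as [a [Hab [H3 H4]]]; eauto. exists a. eauto 6.
  - split.
    + intros a [b [Hab Hby]]. eauto.
    + intros z Hz. apply (proj2 (Hc y)). intros b Hb.
      apply (proj2 (Hc b)). intros a Hab. apply Hz. eauto.
  - apply Hr.
  - exists b. eauto.
Qed.

(** Interpolating between [w] and [s n] preserves the invariant [R w (s n)], so the descent can
    always continue. *)
Lemma interpolating_chain (T : Type) (R : T -> T -> Prop) :
  (forall x y, R x y -> exists m, R x m /\ R m y) ->
  forall w u, R w u -> exists s : nat -> T,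
    s 0 = u /\ forall n, R w (s n) /\ R (s (S n)) (s n).
Proof.
  intros H w u Hwu.
  apply (dependent_choice T (R w) (fun _ x y => R y x)); auto.
Qed.

(** * Points of the quotient frame *)

Section Quotient.
Variables (L : Poset) (A : car L -> Prop).
Hypothesis HL : is_complete_lattice L.

Lemma preceq_congruence : is_congruence_preorder L (preceq_A L A).
Proof.
  split; [|split; [|split]].
  - intros x y z Hxy Hyz R HR HA. apply (proj1 HR) with y; [apply Hxy | apply Hyz]; auto.
  - intros u v Huv R HR HA. apply HR. exact Huv.
  - intros S s v Hs H R HR HA. apply (proj1 (proj2 (proj2 HR))) with S; auto.
    intros u Su. apply H; auto.
  - intros u l m Hm H R HR HA. apply (proj2 (proj2 (proj2 HR))) with l; auto.
    intros v Hv. apply H; auto.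
Qed.

Lemma le_preceq (u v : car L) : le u v -> preceq_A L A u v.
Proof. apply preceq_congruence. Qed.

Lemma preceq_trans (u v w : car L) :
  preceq_A L A u v -> preceq_A L A v w -> preceq_A L A u w.
Proof. apply preceq_congruence. Qed.

Lemma preceq_lub (S : car L -> Prop) (s v : car L) :
  is_lub L S s -> (forall u, S u -> preceq_A L A u v) -> preceq_A L A s v.
Proof. apply preceq_congruence. Qed.

Lemma preceq_meet (u x y m : car L) : is_glb L (pair2 L x y) m ->
  preceq_A L A u x -> preceq_A L A u y -> preceq_A L A u m.
Proof.
  intros Hm Hx Hy.
  apply (proj2 (proj2 (proj2 preceq_congruence))) with (x :: y :: nil).
  - eapply glb_ext; [|exact Hm]. intros z. unfold pair2. simpl. intuition.
  - intros v [<- | [<- | []]]; assumption.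
Qed.

Lemma preceq_of_mem (u a : car L) : A a -> preceq_A L A u a.
Proof.
  intros Aa. destruct (clat_top L HL) as [t Ht].
  apply preceq_trans with t; [apply le_preceq, Ht|].
  intros R HR HA. auto.
Qed.

Lemma cpf_list_glb (F : car L -> Prop) : is_cpf L F ->
  forall (l : list (car L)) m, is_glb L (fun x => In x l) m ->
  (forall v, In v l -> F v) -> F m.
Proof.
  intros [Hup [[t [Ht Ft]] [Hmeet _]]] l. induction l as [|a l IH]; intros m Hm Hl.
  - apply Hup with t; [|exact Ft]. apply Hm. intros y [].
  - destruct (clat_glb L HL (fun x => In x l)) as [k Hk].
    apply (Hmeet a k m); [|apply Hl; left; reflexivity|].
    + split.
      * intros z [-> | ->]; [apply Hm; left; reflexivity|].
        apply Hk. intros y Hy. apply Hm. right. exact Hy.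
      * intros z Hz. apply Hm. intros y [<- | Hy]; [apply Hz; left; reflexivity|].
        apply (clat_trans L HL) with k; [apply Hz; right; reflexivity|].
        apply Hk, Hy.
    + apply IH; [exact Hk|]. intros v Hv. apply Hl. right. exact Hv.
Qed.

(** The implication from [F u] to [F v] is itself a congruence preorder putting the top below each
    member of [A], so it contains the least one. *)
Lemma cpf_preceq (F : car L -> Prop) : is_cpf L F -> (forall a, A a -> F a) ->
  forall u v, preceq_A L A u v -> F u -> F v.
Proof.
  intros HF HFA u v Huv. apply (Huv (fun u v => F u -> F v)).
  - split; [|split; [|split]].
    + auto.
    + intros x y Hxy. apply HF. exact Hxy.
    + intros S s w Hs H Fs. destruct (proj2 (proj2 (proj2 HF)) S s Hs Fs) as [x [Sx Fx]].
      eauto.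
    + intros x l m Hm H Fx. apply (cpf_list_glb F HF l m Hm). auto.
  - auto.
Qed.

(** Joins and meets of [L] remain such in the quotient, where members of [A] become top. Conversely,
    a join or meet in the quotient is compared with a genuine one of [L], and [F] is closed under
    [preceq_A]. *)
Lemma cpf_quot (F : car L -> Prop) :
  is_cpf (quot L A) F <-> is_cpf L F /\ forall a, A a -> F a.
Proof.
  split.
  - intros [Hup [[t [Ht Ft]] [Hm Hj]]]. simpl in *.
    assert (HFle : forall x y, preceq_A L A x y -> F x -> F y) by exact Hup.
    split; [split; [|split; [|split]]|].
    + intros x y Hxy. apply HFle, le_preceq, Hxy.
    + destruct (clat_top L HL) as [t' Ht']. exists t'. split; [exact Ht'|].
      apply HFle with t; auto. apply le_preceq, Ht'.
    + intros x y m Hg. apply Hm. split.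
      * intros z Hz. apply le_preceq, Hg, Hz.
      * intros z Hz. apply preceq_meet with x y; [exact Hg| |]; apply Hz;
          [left|right]; reflexivity.
    + intros S s Hs. apply Hj. split.
      * intros z Hz. apply le_preceq, Hs, Hz.
      * intros z Hz. apply preceq_lub with S; auto.
    + intros a Aa. apply HFle with t; auto. apply preceq_of_mem, Aa.
  - intros [HF HFA]. pose proof (cpf_preceq F HF HFA) as HFle.
    destruct HF as [Hup [[t [Ht Ft]] [Hm Hj]]].
    split; [|split; [|split]].
    + exact HFle.
    + exists t. split; [|exact Ft]. intros y. apply le_preceq, Ht.
    + intros x y m Hg Fx Fy. destruct (clat_glb L HL (pair2 L x y)) as [k Hk].
      apply HFle with k; [|eapply Hm; eauto]. apply Hg.
      intros z Hz. apply le_preceq, Hk, Hz.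
    + intros S s Hs Fs. destruct (proj2 HL S) as [j Hj'].
      apply (Hj S j Hj'). apply HFle with s; [|exact Fs]. apply Hs.
      intros z Hz. apply le_preceq, Hj', Hz.
Qed.

(* Baire-style argument: shrink [u] below all of [A] along a chain for the
   way-below relation, never entering the elements [preceq_A]-below [v]. *)
Lemma quot_separation (u v : car L) :
  is_distributive L -> is_continuous L -> countable L A -> ~ preceq_A L A u v ->
  exists F, is_cpf (quot L A) F /\ F u /\ ~ F v.
Proof.
  intros Hd Hc [g Hg] Huv.
  (* Stage [n] imposes the member of [A] numbered [n] by [g]; injectivity of [g] on [A] leaves at
     most one. *)
  destruct (dependent_choice (car L) (fun x => ~ preceq_A L A x v)
    (fun n x y => way_below L y x /\ forall a, A a -> g a = n -> le y a) u Huv)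
    as [s [Hs0 Hs]].
  - intros n x Hx.
    assert (E : exists m, le m x /\ preceq_A L A x m /\ forall a, A a -> g a = n -> le m a).
    { destruct (boolp.EM (exists a, A a /\ g a = n)) as [[a [Aa Ha]] | HN].
      - destruct (clat_glb L HL (pair2 L x a)) as [m Hm]. exists m.
        split; [apply Hm; left; reflexivity|]. split.
        + apply preceq_meet with x a; auto using preceq_of_mem.
          apply le_preceq, clat_refl, HL.
        + intros b Ab Hb. rewrite (Hg b a) by congruence. apply Hm. right. reflexivity.
      (* No member of [A] has number [n], so nothing is imposed and [m] is [x]. *)
      - exists x. split; [apply clat_refl, HL|].
        split; [apply le_preceq, clat_refl, HL|]. intros a Aa Ha. exfalso. eauto. }
    destruct E as [m [Hmx [Hxm Hma]]].
    (* If every [w] way below [m] were below [v] in the quotient, so would be their join [m], and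
       hence [x]. *)
    apply boolp.contrapT. intros HN. apply Hx. apply preceq_trans with m; [exact Hxm|].
    apply preceq_lub with (1 := proj2 (Hc m)). intros w Hw.
    apply boolp.contrapT. intros Hwv. apply HN. exists w. split; [exact Hwv|].
    split.
    + intros D t HD Ht Hxt. apply (Hw D t HD Ht). eapply clat_trans; eauto.
    + intros a Aa Ha. eapply (clat_trans L HL); [|eauto]. apply way_below_le; auto.
  - destruct (scott_open_filter_separation L HL (fun w => exists n, le (s n) w) v)
      as [F [HF [HFs HFv]]]; auto.
    + apply way_below_chain_filter; auto. intros n. apply Hs.
    + intros [n Hn]. apply (proj1 (Hs n)), le_preceq, Hn.
    + exists F. split; [|split; [|exact HFv]].
      * apply cpf_quot. split; [exact HF|]. intros a Aa. apply HFs.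
        (* The element [a] is imposed in passing from stage [g a] to the next one, hence the
           successor. *)
        exists (S (g a)). apply Hs; auto.
      * apply HFs. exists 0. rewrite Hs0. apply clat_refl, HL.
Qed.

End Quotient.

(** * Isomorphisms of preordered frames and the counit *)

(** Mutually inverse monotone maps carry bounds back and forth, hence also least and greatest ones.
    Inverses are taken up to [pequiv] because the quotient order is only a preorder. *)
Lemma order_equiv_frame_hom (F G : Poset) (f : car F -> car G) (g : car G -> car F) :
  (forall x y z : car F, le x y -> le y z -> le x z) ->
  (forall x y z : car G, le x y -> le y z -> le x z) ->
  (forall x y, le x y -> le (f x) (f y)) -> (forall x y, le x y -> le (g x) (g y)) ->
  (forall a, pequiv F (g (f a)) a) -> (forall b, pequiv G (f (g b)) b) ->
  frame_hom F G f.
Proof.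
  intros tF tG mf mg gf fg. split.
  - intros S s [H1 H2]. split.
    + intros y [x [Sx ->]]. auto.
    + intros z Hz. apply tG with (f (g z)); [|apply fg]. apply mf, H2. intros x Sx.
      apply tF with (g (f x)); [apply gf|]. apply mg, Hz. eauto.
  - intros l m [H1 H2]. split.
    + intros y Hy. apply in_map_iff in Hy as [x [<- Hx]]. auto.
    + intros z Hz. apply tG with (f (g z)); [apply fg|]. apply mf, H2. intros x Hx.
      apply tF with (g (f x)); [|apply gf]. apply mg, Hz. apply in_map, Hx.
Qed.

Lemma order_equiv_frame_iso (F G : Poset) (f : car F -> car G) (g : car G -> car F) :
  (forall x y z : car F, le x y -> le y z -> le x z) ->
  (forall x y z : car G, le x y -> le y z -> le x z) ->
  (forall x y, le x y -> le (f x) (f y)) -> (forall x y, le x y -> le (g x) (g y)) ->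
  (forall a, pequiv F (g (f a)) a) -> (forall b, pequiv G (f (g b)) b) ->
  frame_iso_map F G f.
Proof.
  intros. split; [apply (order_equiv_frame_hom F G f g); auto|].
  exists g. split; [apply (order_equiv_frame_hom G F g f); auto|auto].
Qed.

(** By separation [eps] reflects the order; its surjectivity is the definition of the topology on
    points, and [g] picks an element naming each open set. *)
Lemma quot_counit_iso (L : Poset) (A : car L -> Prop) :
  dist_cont_clat L -> countable L A -> counit_iso (quot L A).
Proof.
  intros [HL [Hd Hc]] HA.
  set (Q := quot L A).
  destruct (boolp.choice (fun V : car (O (pt Q)) => proj2_sig V)) as [g Hg]. simpl in g.
  assert (Heps : forall u v : car Q, le (eps Q u) (eps Q v) -> le u v).
  { intros u v H. apply boolp.contrapT. intros Huv.
    destruct (quot_separation L A HL u v Hd Hc HA Huv) as [F [HF [Fu Fv]]].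
    apply Fv. exact (H (exist _ F HF) Fu). }
  assert (Hup : forall u v : car Q, le u v -> le (eps Q u) (eps Q v)).
  { intros u v Huv [F HF]. simpl. apply (proj1 HF). exact Huv. }
  assert (Hge : forall V, pequiv (O (pt Q)) (eps Q (g V)) V).
  { intros V. split; intros p; simpl; apply Hg. }
  apply (order_equiv_frame_iso Q (O (pt Q)) (eps Q) g).
  - intros x y z. apply preceq_trans.
  - intros x y z Hxy Hyz p Hp. apply Hyz, Hxy, Hp.
  - exact Hup.
  - intros U V HUV. apply Heps. intros p Hp. apply Hge, HUV, Hge, Hp.
  - intros u. split; apply Heps; intros p; simpl; apply (Hg (eps Q u)).
  - exact Hge.
Qed.

(** * The frame of open sets *)

Section OpenSets.
Variable X : Space.
Hypothesis HX : is_topology X.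

(** Meets and joins in [O X] are given only by universal properties; comparing them with actual
    intersections and unions shows how membership of [x] behaves. *)
Lemma nbhd_cpf (x : pts X) : is_cpf (O X) (fun U => proj1_sig U x).
Proof.
  destruct HX as [Hext [HT [HI HU]]]. split; [|split; [|split]].
  - intros U V HUV. apply HUV.
  - exists (exist _ _ HT). split; [|exact I]. intros U y _. exact I.
  - intros [U OU] [V OV] m [_ Hm] Ux Vx.
    apply (Hm (exist _ _ (HI U V OU OV))); [|split; assumption].
    intros W [-> | ->] y [Uy Vy]; assumption.
  - intros S s [_ Hs] sx.
    set (F := fun V => exists W, S W /\ proj1_sig W = V).
    assert (OF : opn (fun x => exists V, F V /\ V x)).
    { apply HU. intros V [W [_ <-]]. exact (proj2_sig W). }
    destruct (Hs (exist _ _ OF)) with x as [V [[W [SW <-]] Wx]]; eauto.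
    intros W SW y Wy. exists (proj1_sig W). split; [exists W; auto|exact Wy].
Qed.

Lemma O_partial_order : is_partial_order (O X).
Proof.
  split; [|split].
  - intros U x Ux. exact Ux.
  - intros U V W HUV HVW x Ux. apply HVW, HUV, Ux.
  - intros U V HUV HVU. apply sig_ext, pred_ext. intros x. split; [apply HUV|apply HVU].
Qed.

Lemma O_complete_lattice : is_complete_lattice (O X).
Proof.
  split; [exact O_partial_order|]. intros S.
  assert (OS : opn (fun x => exists V, (exists W : car (O X), S W /\ proj1_sig W = V) /\ V x)).
  { apply HX. intros V [W [_ <-]]. exact (proj2_sig W). }
  exists (exist _ _ OS). split.
  - intros W SW x Wx. exists (proj1_sig W). eauto.
  - intros Z HZ x [V [[W [SW <-]] Wx]]. exact (HZ W SW x Wx).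
Qed.

Lemma O_lub_iff (S : car (O X) -> Prop) (s : car (O X)) (x : pts X) :
  is_lub (O X) S s -> (proj1_sig s x <-> exists U, S U /\ proj1_sig U x).
Proof.
  intros Hs. split.
  - apply (nbhd_cpf x), Hs.
  - intros [U [SU Ux]]. exact (proj1 Hs U SU x Ux).
Qed.

Lemma O_meet_iff (U V m : car (O X)) (x : pts X) :
  is_glb (O X) (pair2 (O X) U V) m -> (proj1_sig m x <-> proj1_sig U x /\ proj1_sig V x).
Proof.
  intros Hm. split.
  - intros mx. split; apply (proj1 Hm); auto; [left|right]; reflexivity.
  - intros [Ux Vx]. exact (proj1 (proj2 (proj2 (nbhd_cpf x))) U V m Hm Ux Vx).
Qed.

Lemma O_join_iff (U V j : car (O X)) (x : pts X) :
  is_lub (O X) (pair2 (O X) U V) j -> (proj1_sig j x <-> proj1_sig U x \/ proj1_sig V x).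
Proof.
  intros Hj. rewrite (O_lub_iff _ _ x Hj). split.
  - intros [W [[-> | ->] Wx]]; auto.
  - intros [H | H]; eexists; (split; [|exact H]); [left|right]; reflexivity.
Qed.

Lemma O_distributive : is_distributive (O X).
Proof.
  intros U V W VW m UV UW k H1 H2 H3 H4 H5.
  apply sig_ext, pred_ext. intros x.
  rewrite (O_meet_iff _ _ _ x H2), (O_join_iff _ _ _ x H1), (O_join_iff _ _ _ x H5),
    (O_meet_iff _ _ _ x H3), (O_meet_iff _ _ _ x H4). tauto.
Qed.

(** A finite subcover drawn from [D] has, by directedness, an upper bound in [D]. *)
Lemma compact_directed_cover (K : pts X -> Prop) (D : car (O X) -> Prop) (s : car (O X)) :
  compact X K -> directed (O X) D -> is_lub (O X) D s ->
  (forall x, K x -> proj1_sig s x) -> exists d, D d /\ forall x, K x -> proj1_sig d x.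
Proof.
  intros HK HD Hs HKs.
  destruct (HK (fun U => exists d, D d /\ proj1_sig d = U)) as [l [Hl HKl]].
  - intros U [d [_ <-]]. exact (proj2_sig d).
  - intros x Kx. apply HKs, (O_lub_iff _ _ x Hs) in Kx as [d [Dd dx]].
    exists (proj1_sig d). eauto.
  - assert (E : exists d, D d /\ forall U, In U l -> forall x, U x -> proj1_sig d x).
    { clear HKl. induction l as [|U l IH].
      - destruct HD as [[d Dd] _]. exists d. split; [exact Dd|]. intros U [].
      - destruct IH as [d [Dd Hd]]; [intros V HV; apply Hl; right; exact HV|].
        destruct (Hl U (or_introl eq_refl)) as [e [De <-]].
        destruct (proj2 HD d e Dd De) as [c [Dc [Hdc Hec]]].
        exists c. split; [exact Dc|]. intros V [<- | HV] x Vx; [exact (Hec x Vx)|].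
        exact (Hdc x (Hd V HV x Vx)). }
    destruct E as [d [Dd Hd]]. exists d. split; [exact Dd|]. intros x Kx.
    destruct (HKl x Kx) as [U [HU Ux]]. eauto.
Qed.

(** An open [V] inside a compact [K] inside [U] is way below [U], and local compactness covers [U]
    by such [V]. *)
Lemma O_continuous : locally_compact X -> is_continuous (O X).
Proof.
  intros Hlc U. split; [apply way_below_directed, O_complete_lattice|]. split.
  - intros V HV. exact (way_below_le _ O_complete_lattice V U HV).
  - intros Z HZ x Ux.
    destruct (Hlc x (proj1_sig U) (proj2_sig U) Ux) as [K [V [HK [_ [OV [Vx [HVK HKU]]]]]]].
    apply (HZ (exist _ V OV)); [|exact Vx].
    intros D s HD Hs HUs.
    destruct (compact_directed_cover K D s HK HD Hs) as [d [Dd Hd]].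
    + intros y Ky. apply HUs, HKU, Ky.
    + exists d. split; [exact Dd|]. intros y Vy. apply Hd, HVK, Vy.
Qed.

Lemma sober_unit_iso : sober X -> unit_iso X.
Proof.
  intros Hs.
  destruct (boolp.choice (fun p : pts (pt (O X)) =>
    let (x, Hx) := Hs (proj1_sig p) (proj2_sig p) in ex_intro _ x (proj1 Hx))) as [g Hg].
  exists (fun x => exist _ _ (nbhd_cpf x)). split; [intros x U; apply iff_refl|]. split.
  - intros V [U HU]. apply (proj1 HX) with (proj1_sig U); [|exact (proj2_sig U)].
    intros x. rewrite HU. apply iff_refl.
  - exists g. split; [|split].
    + intros V OV. exists (exist _ V OV). intros p. rewrite Hg. apply iff_refl.
    + intros x. set (p := exist _ _ (nbhd_cpf x) : pts (pt (O X))).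
      destruct (Hs (proj1_sig p) (proj2_sig p)) as [y [_ Hy]].
      transitivity y; [symmetry|]; apply Hy; [apply Hg|].
      intros U. apply iff_refl.
    + intros p. apply sig_ext, pred_ext. intros U. simpl. symmetry. apply Hg.
Qed.

End OpenSets.

(** * Embeddings with G_δ image *)

(** A topological embedding with image [G], phrased on points of [Y] to avoid the subtype behind
    [subspace Y G]. *)
Definition embeds_onto (X Y : Space) (f : pts X -> pts Y) (G : pts Y -> Prop) :=
  (forall V : pts X -> Prop,
     opn V <-> exists U : pts Y -> Prop, opn U /\ forall x, V x <-> U (f x)) /\
  (forall x y, f x = f y -> x = y) /\
  (forall y, G y <-> exists x, f x = y).

Lemma homeomorphic_subspace_embeds (X Y : Space) (G : pts Y -> Prop) :
  is_topology X -> homeomorphic X (subspace Y G) -> exists f, embeds_onto X Y f G.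
Proof.
  intros HX [h [Hh [g [Hg [gh hg]]]]].
  exists (fun x => proj1_sig (h x)). split; [|split].
  - intros V. split.
    + intros OV. destruct (Hg V OV) as [U [OU HU]]. exists U. split; [exact OU|].
      intros x. rewrite <- HU, gh. apply iff_refl.
    + intros [U [OU HU]]. apply (proj1 HX) with (fun x => U (proj1_sig (h x))).
      * intros x. symmetry. apply HU.
      * apply (Hh (fun p => U (proj1_sig p))). exists U. split; [exact OU|].
        intros p. apply iff_refl.
  - intros x y Hxy. rewrite <- (gh x), <- (gh y). f_equal. apply sig_ext, Hxy.
  - intros y. split.
    + intros Gy. exists (g (exist _ y Gy)). rewrite hg. reflexivity.
    + intros [x <-]. exact (proj2_sig (h x)).
Qed.

Section Embedding.
Variables (X Y : Space) (f : pts X -> pts Y) (G : pts Y -> Prop).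
Hypotheses (HY : is_topology Y) (HYs : sober Y)
  (HG : G_delta Y G) (Hf : embeds_onto X Y f G).

Lemma embedding_preimage_open (U : car (O Y)) : opn (fun x => proj1_sig U (f x)).
Proof.
  apply (proj1 Hf). exists (proj1_sig U). split; [exact (proj2_sig U)|].
  intros x. apply iff_refl.
Qed.

Definition embedding_preimage (U : car (O Y)) : car (O X) :=
  exist _ _ (embedding_preimage_open U).

Lemma embedding_preimage_surj (V : car (O X)) :
  exists U : car (O Y), forall x, proj1_sig V x <-> proj1_sig U (f x).
Proof.
  destruct (proj1 (proj1 Hf _) (proj2_sig V)) as [U [OU HU]].
  exists (exist _ U OU). exact HU.
Qed.

(** A completely prime filter on [X] is pushed forward to [Y], where sobriety gives a point [y].
    Each open set of the G_δ presentation restricts to all of [X], so it contains [y]; thus [y] lies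
    in the image of [f]. *)
Lemma G_delta_embedding_sober : sober X.
Proof.
  intros P [Hup [[t [Ht Pt]] [Hm Hj]]].
  assert (HQ : is_cpf (O Y) (fun U => P (embedding_preimage U))).
  { split; [|split; [|split]].
    - intros U V HUV. apply Hup. intros x. apply HUV.
    - exists (exist _ _ (proj1 (proj2 HY))). split.
      + intros U y _. exact I.
      + apply Hup with t; [|exact Pt]. intros x _. exact I.
    - intros U V m Hg. apply Hm. split.
      + intros W [-> | ->] x mx; apply (O_meet_iff Y HY _ _ _ _ Hg) in mx; apply mx.
      + intros W HW x Wx. apply (O_meet_iff Y HY _ _ _ _ Hg). split.
        * exact (HW _ (or_introl eq_refl) x Wx).
        * exact (HW _ (or_intror eq_refl) x Wx).
    - intros S s Hs Ps.
      destruct (Hj (fun V => exists U, S U /\ V = embedding_preimage U)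
        (embedding_preimage s)) as [V [[U [SU ->]] PU]]; [|exact Ps|eauto].
      split.
      + intros V [U [SU ->]] x Ux. apply (O_lub_iff Y HY _ _ _ Hs). eauto.
      + intros W HW x sx. apply (O_lub_iff Y HY _ _ _ Hs) in sx as [U [SU Ux]].
        exact (HW _ (ex_intro _ U (conj SU eq_refl)) x Ux). }
  destruct (HYs _ HQ) as [y [Hy Huniq]].
  assert (Gy : G y).
  { destruct HG as [U [OU HU]]. apply HU. intros n.
    apply (Hy (exist _ _ (OU n))). apply Hup with t; [|exact Pt].
    intros x _. simpl. apply HU. apply Hf. eauto. }
  apply Hf in Gy as [x <-].
  exists x. split.
  - intros V. destruct (embedding_preimage_surj V) as [U HU]. rewrite HU, <- Hy.
    split; apply Hup; intros z; apply HU.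
  - intros z Hz. apply Hf. apply Huniq. intros U. apply Hz.
Qed.

(** The crux is [Hpre]: the quotient order is inclusion of traces on [X]. Neighbourhood filters of
    the points [f x] respect the quotient order since they contain [A]; conversely, a separating
    filter contains [A], and sobriety turns it into a point of [G]. *)
Lemma G_delta_embedding_frame_iso : locally_compact Y ->
  exists A, countable (O Y) A /\ frame_iso (O X) (quot (O Y) A).
Proof.
  intros Hlc.
  pose proof (O_complete_lattice Y HY) as HL.
  destruct HG as [U [OU HU]].
  set (A := fun V : car (O Y) => exists n, proj1_sig V = U n).
  assert (HA : countable (O Y) A).
  { destruct (boolp.choice (X := car (O Y)) (Y := nat)
      (P := fun V n => A V -> proj1_sig V = U n)) as [g Hg].
    - intros V. destruct (boolp.EM (A V)) as [[n Hn] | HN]; [exists n; auto|].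
      exists 0. tauto.
    - exists g. intros V W AV AW E. apply sig_ext.
      rewrite (Hg V AV), (Hg W AW), E. reflexivity. }
  assert (Hpre : forall V W, preceq_A (O Y) A V W <->
    forall x, proj1_sig V (f x) -> proj1_sig W (f x)).
  { intros V W. split.
    - intros HVW x.
      apply (cpf_preceq (O Y) A HL _ (nbhd_cpf Y HY (f x))); [|exact HVW].
      intros B [n ->]. apply HU. apply Hf. eauto.
    - intros HVW. apply boolp.contrapT. intros HN.
      destruct (quot_separation (O Y) A HL V W) as [F [HF [FV FW]]];
        auto using O_distributive, O_continuous.
      apply cpf_quot in HF as [HF HFA]; [|exact HL].
      destruct (HYs F HF) as [y [Hy _]].
      assert (Gy : G y).
      { apply HU. intros n. apply (Hy (exist _ _ (OU n))). apply HFA. exists n. reflexivity. }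
      apply Hf in Gy as [x <-]. apply FW, Hy, HVW, Hy, FV. }
  exists A. split; [exact HA|].
  (* [e] chooses an open extension to [Y]; by [Hpre] all extensions of one set are equivalent in the
     quotient. *)
  destruct (boolp.choice embedding_preimage_surj) as [e He].
  exists e. apply (order_equiv_frame_iso (O X) (quot (O Y) A) e embedding_preimage).
  - apply O_partial_order.
  - intros V W Z. apply preceq_trans.
  - intros V W HVW. apply Hpre. intros x Vx. apply He, HVW, He, Vx.
  - intros V W HVW. exact (proj1 (Hpre V W) HVW).
  - intros V. split; intros x; simpl; apply He.
  - intros V. split; apply Hpre; intros x Vx; apply (He (embedding_preimage V)); exact Vx.
Qed.

End Embedding.

(** * The space of points of a complete lattice *)

Section Points.
Variable L : Poset.
Hypothesis HL : is_complete_lattice L.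

Lemma cpf_lub_iff (F : car L -> Prop) (S : car L -> Prop) (s : car L) :
  is_cpf L F -> is_lub L S s -> (F s <-> exists x, S x /\ F x).
Proof.
  intros HF Hs. split; [apply HF, Hs|].
  intros [x [Sx Fx]]. apply (proj1 HF) with x; [|exact Fx]. apply Hs, Sx.
Qed.

Lemma cpf_meet_iff (F : car L -> Prop) (x y m : car L) :
  is_cpf L F -> is_glb L (pair2 L x y) m -> (F m <-> F x /\ F y).
Proof.
  intros HF Hm. split.
  - intros Fm. split; apply (proj1 HF) with m; auto; apply Hm; [left|right]; reflexivity.
  - intros [Fx Fy]. exact (proj1 (proj2 (proj2 HF)) x y m Hm Fx Fy).
Qed.

Lemma cpf_top (F : car L -> Prop) (t : car L) : is_cpf L F -> is_top L t -> F t.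
Proof.
  intros [Hup [[t' [_ Ft']] _]] Ht. apply Hup with t'; auto.
Qed.

Lemma pt_topology : is_topology (pt L).
Proof.
  split; [|split; [|split]].
  - intros U V H [u Hu]. exists u. intros p. rewrite <- H. apply Hu.
  - destruct (clat_top L HL) as [t Ht]. exists t. intros p. split; [|intros _; exact I].
    intros _. exact (cpf_top _ t (proj2_sig p) Ht).
  - intros U V [u Hu] [v Hv]. destruct (clat_glb L HL (pair2 L u v)) as [m Hm].
    exists m. intros p. rewrite Hu, Hv, (cpf_meet_iff _ _ _ _ (proj2_sig p) Hm).
    apply iff_refl.
  - intros F HF.
    destruct (proj2 HL (fun u => exists U, F U /\ forall p, U p <-> proj1_sig p u)) as [j Hj].
    exists j. intros p. rewrite (cpf_lub_iff _ _ _ (proj2_sig p) Hj). split.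
    + intros [U [FU Up]]. destruct (HF U FU) as [u Hu]. exists u.
      split; [exists U; auto|]. apply Hu, Up.
    + intros [u [[U [FU Hu]] pu]]. exists U. split; [exact FU|]. apply Hu, pu.
Qed.

(** Pulling [P] back along [eps] gives a completely prime filter of [L], which is the required point
    because every open set of [pt L] is some [eps L u]. *)
Lemma pt_sober : sober (pt L).
Proof.
  intros P HP.
  assert (HF : is_cpf L (fun u => P (eps L u))).
  { split; [|split; [|split]].
    - intros x y Hxy. apply HP. intros p. apply (proj2_sig p). exact Hxy.
    - destruct (clat_top L HL) as [t Ht]. exists t. split; [exact Ht|].
      destruct HP as [Hup [[T [_ PT]] _]]. apply Hup with T; [|exact PT].
      intros p _. exact (cpf_top _ t (proj2_sig p) Ht).
    - intros x y m Hm. apply HP. split.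
      + intros W [-> | ->] p pm; apply (cpf_meet_iff _ _ _ _ (proj2_sig p) Hm); exact pm.
      + intros W HW p Wp. apply (cpf_meet_iff _ _ _ _ (proj2_sig p) Hm). split.
        * exact (HW _ (or_introl eq_refl) p Wp).
        * exact (HW _ (or_intror eq_refl) p Wp).
    - intros S s Hs Ps.
      destruct (proj2 (proj2 (proj2 HP)) (fun V => exists u, S u /\ V = eps L u) (eps L s))
        as [V [[u [Su ->]] Pu]]; [|exact Ps|eauto].
      split.
      + intros V [u [Su ->]] p pu. apply (cpf_lub_iff _ _ _ (proj2_sig p) Hs). eauto.
      + intros W HW p ps. apply (cpf_lub_iff _ _ _ (proj2_sig p) Hs) in ps as [u [Su pu]].
        exact (HW _ (ex_intro _ u (conj Su eq_refl)) p pu). }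
  exists (exist _ _ HF). split.
  - intros U. destruct (proj2_sig U) as [u Hu]. rewrite Hu. simpl.
    split; apply HP; intros p; simpl; apply Hu.
  - intros p Hp. apply sig_ext, pred_ext. intros u. simpl. apply (Hp (eps L u)).
Qed.

(** One half of the Hofmann-Mislove correspondence. Were the join [v] of the elements naming the
    cover outside [Phi], a separating point would contain [Phi] yet escape the cover. Finite joins
    of these elements are directed with join [v], so one of them lies in [Phi] and gives a finite
    subcover. *)
Lemma scott_open_filter_compact (Phi : car L -> Prop) :
  is_distributive L -> scott_open_filter L Phi ->
  compact (pt L) (fun p => forall w, Phi w -> proj1_sig p w).
Proof.
  intros Hd HPhi Fam HFam Hcov.
  set (S := fun u => Fam (fun p => proj1_sig p u)).
  destruct (proj2 HL S) as [v Hv].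
  assert (HPv : Phi v).
  { apply boolp.contrapT. intros HN.
    destruct (scott_open_filter_separation L HL Phi v Hd HPhi HN) as [F [HF [HPF HFv]]].
    destruct (Hcov (exist _ F HF) HPF) as [U [FU Up]].
    destruct (HFam U FU) as [u Hu]. apply HFv.
    apply (cpf_lub_iff _ _ _ HF Hv). exists u. split.
    - rewrite (pred_ext _ _ _ Hu) in FU. exact FU.
    - apply Hu in Up. exact Up. }
  set (D := fun j => exists l, (forall x, In x l -> S x) /\ is_lub L (fun x => In x l) j).
  assert (Hlub : forall l, (forall x, In x l -> S x) ->
    exists j, D j /\ forall x, In x l -> le x j).
  { intros l Hl. destruct (proj2 HL (fun x => In x l)) as [j Hj].
    exists j. split; [exists l; auto|]. apply Hj. }
  destruct (proj2 (proj2 (proj2 HPhi)) D v) as [j [[l [Hl Hj]] Pj]]; [| |exact HPv|].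
  - split.
    + destruct (Hlub nil) as [j [Dj _]]; [intros x []|eauto].
    + intros a b [l1 [Hl1 Ha]] [l2 [Hl2 Hb]].
      destruct (Hlub (l1 ++ l2)) as [j [Dj Hj]].
      * intros x Hx. apply in_app_or in Hx as [Hx | Hx]; auto.
      * exists j. split; [exact Dj|]. split; [apply Ha|apply Hb];
          intros x Hx; apply Hj, in_or_app; auto.
  - split.
    + intros j [l [Hl Hj]]. apply Hj. intros x Hx. apply Hv. auto.
    + intros z Hz. apply Hv. intros x Sx. destruct (Hlub (x :: nil)) as [j [Dj Hj]].
      * intros y [<- | []]. exact Sx.
      * apply (clat_trans L HL) with j; [apply Hj; left; reflexivity|apply Hz, Dj].
  - exists (map (fun u (p : pts (pt L)) => proj1_sig p u) l). split.
    + intros U HU. apply in_map_iff in HU as [x [<- Hx]]. apply Hl, Hx.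
    + intros p Hp.
      destruct (proj1 (cpf_lub_iff _ _ _ (proj2_sig p) Hj) (Hp j Pj)) as [x [Hx px]].
      exists (fun p => proj1_sig p x). split; [|exact px].
      apply in_map_iff. exists x. split; [reflexivity|exact Hx].
Qed.

(** A chain interpolated between some [w] in [p] and [u] generates a Scott-open filter. The points
    containing it form a compact set lying inside the open set of [u] and around that of [w]. *)
Lemma pt_locally_compact : is_distributive L -> is_continuous L -> locally_compact (pt L).
Proof.
  intros Hd Hc p U [u Hu] Up. apply Hu in Up.
  apply (cpf_lub_iff _ _ _ (proj2_sig p) (proj2 (Hc u))) in Up as [w [Hwu pw]].
  destruct (interpolating_chain _ (way_below L)
    (way_below_interpolation L (proj1 HL) Hc) w u Hwu) as [s [Hs0 Hs]].
  set (Phi := fun v => exists n, le (s n) v).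
  assert (HPhi : scott_open_filter L Phi).
  { apply way_below_chain_filter; [exact HL|]. intros n. apply Hs. }
  exists (fun q => forall v, Phi v -> proj1_sig q v), (fun q => proj1_sig q w).
  split; [|split; [|split; [|split; [|split]]]].
  - apply scott_open_filter_compact; assumption.
  - intros q Hq v Pv. apply (Hq (fun q => proj1_sig q v)).
    + exists v. intros r. apply iff_refl.
    + intros r Hr. apply Hr, Pv.
  - exists w. intros q. apply iff_refl.
  - exact pw.
  - intros q qw v [n Hn]. apply (proj1 (proj2_sig q)) with w; [|exact qw].
    apply (clat_trans L HL) with (s n); [|exact Hn]. apply way_below_le; [exact HL|].
    apply Hs.
  - intros q Hq. apply Hu, Hq. exists 0. rewrite Hs0. apply clat_refl, HL.
Qed.

Variable A : car L -> Prop.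

Definition points_containing : pts (pt L) -> Prop :=
  fun p => forall a, A a -> proj1_sig p a.

Lemma points_containing_G_delta : countable L A -> G_delta (pt L) points_containing.
Proof.
  intros [g Hg].
  (* When no member of [A] is numbered [n], the condition is vacuous and the [n]-th open set is the
     whole space. *)
  exists (fun n p => forall a, A a -> g a = n -> proj1_sig p a). split.
  - intros n. destruct (boolp.EM (exists a, A a /\ g a = n)) as [[a [Aa Ha]] | HN].
    + exists a. intros p. split; [intros Hp; auto|].
      intros pa b Ab Hb. rewrite (Hg b a) by congruence. exact pa.
    + apply (proj1 pt_topology) with (fun _ => True); [|apply pt_topology].
      intros p. split; [|intros _; exact I]. intros _ a Aa Ha. exfalso. eauto.
  - intros p. split; [intros Hp n a Aa _; auto|]. intros Hp a Aa. eauto.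
Qed.

(** By [cpf_quot] both sides have the same underlying filters, and their open sets are named by the
    same elements of [L]. *)
Lemma pt_quot_homeomorphic :
  homeomorphic (pt (quot L A)) (subspace (pt L) points_containing).
Proof.
  pose proof (cpf_quot L A HL) as HQ.
  exists (fun p => exist points_containing
            (exist (is_cpf L) (proj1_sig p) (proj1 (proj1 (HQ _) (proj2_sig p))))
            (proj2 (proj1 (HQ _) (proj2_sig p)))).
  split.
  - intros V [U [[u Hu] HU]]. exists u. intros p. rewrite HU, Hu. apply iff_refl.
  - exists (fun q => exist (is_cpf (quot L A)) (proj1_sig (proj1_sig q))
              (proj2 (HQ _) (conj (proj2_sig (proj1_sig q)) (proj2_sig q)))).
    split; [|split].
    + intros V [u Hu]. exists (fun p => proj1_sig p u). split.
      * exists u. intros p. apply iff_refl.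
      * intros q. rewrite Hu. apply iff_refl.
    + intros p. apply sig_ext. reflexivity.
    + intros q. apply sig_ext, sig_ext. reflexivity.
Qed.

End Points.

Lemma pt_quot_LCS_complete (L : Poset) (A : car L -> Prop) :
  dist_cont_clat L -> countable L A -> LCS_complete (pt (quot L A)).
Proof.
  intros [HL [Hd Hc]] HA. exists (pt L).
  split; [apply pt_topology, HL|]. split; [apply pt_sober, HL|].
  split; [apply pt_locally_compact; assumption|].
  exists (points_containing L A). split.
  - apply points_containing_G_delta; assumption.
  - apply pt_quot_homeomorphic, HL.
Qed.

(** * The Scott topology of a continuous dcpo *)

Section Scott.
Variable D : Poset.
Hypotheses (HD : is_dcpo D) (HC : is_continuous D).

Lemma dcpo_trans (x y z : car D) : le x y -> le y z -> le x z.
Proof. apply (proj1 HD). Qed.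

Lemma scott_topology : is_topology (scott D).
Proof.
  split; [|split; [|split]].
  - intros U V H [H1 H2]. rewrite <- (pred_ext _ _ _ H). split; assumption.
  - split; [auto|]. intros S s [[d Sd] _] _ _. eauto.
  - intros U V [HU1 HU2] [HV1 HV2]. split.
    + intros x y Hxy [Ux Vx]. eauto.
    + intros S s HS Hs [Us Vs].
      destruct (HU2 S s HS Hs Us) as [a [Sa Ua]]. destruct (HV2 S s HS Hs Vs) as [b [Sb Vb]].
      destruct (proj2 HS a b Sa Sb) as [c [Sc [Hac Hbc]]]. exists c. eauto.
  - intros F HF. split.
    + intros x y Hxy [U [FU Ux]]. exists U. split; [exact FU|]. exact (proj1 (HF U FU) x y Hxy Ux).
    + intros S s HS Hs [U [FU Us]].
      destruct (proj2 (HF U FU) S s HS Hs Us) as [d [Sd Ud]]. eauto.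
Qed.

(** Interpolating [d] ≪ [m] ≪ [s] puts [m] below a member of [S], and [d] is then way below that
    member. *)
Lemma way_below_upset_open (d : car D) : @opn (scott D) (fun x => way_below D d x).
Proof.
  split.
  - intros x y Hxy Hdx S s HS Hs Hys. apply (Hdx S s HS Hs). eapply dcpo_trans; eauto.
  - intros S s HS Hs Hds.
    destruct (way_below_interpolation D (proj1 HD) HC d s Hds) as [m [Hdm Hms]].
    destruct (Hms S s HS Hs) as [e [Se Hme]]; [apply (proj1 HD)|].
    exists e. split; [exact Se|]. intros S' s' HS' Hs' Hes'. apply (Hdm S' s' HS' Hs').
    eapply dcpo_trans; eauto.
Qed.

Lemma scott_open_way_below (U : pts (scott D) -> Prop) (x : car D) :
  opn U -> U x -> exists d, U d /\ way_below D d x.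
Proof.
  intros [_ HU] Ux. destruct (HU _ x (proj1 (HC x)) (proj2 (HC x)) Ux) as [d [Hd Ud]]. eauto.
Qed.

Lemma scott_way_below_sub (U : pts (scott D) -> Prop) (d x : car D) :
  opn U -> U d -> way_below D d x -> U x.
Proof.
  intros [HU _] Ud Hdx. apply HU with d; [|exact Ud]. apply (proj2 (HC x)), Hdx.
Qed.

Definition way_above (d : car D) : car (O (scott D)) := exist _ _ (way_below_upset_open d).

Lemma scott_open_lub (U : car (O (scott D))) :
  is_lub (O (scott D)) (fun V => exists d, proj1_sig U d /\ V = way_above d) U.
Proof.
  split.
  - intros V [d [Ud ->]] x. apply scott_way_below_sub; [exact (proj2_sig U)|exact Ud].
  - intros V HV x Ux. destruct (scott_open_way_below _ x (proj2_sig U) Ux) as [d [Ud Hd]].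
    exact (HV _ (ex_intro _ d (conj Ud eq_refl)) x Hd).
Qed.

(** Each open [U] is the union of [way_above d] over [d] in [U], so a completely prime filter
    containing [U] contains one of these. The [d] arising this way form a directed set [E], whose
    join is the point. *)
Lemma scott_sober : sober (scott D).
Proof.
  intros P HP. pose proof (O_complete_lattice _ scott_topology) as HO.
  set (E := fun d => P (way_above d)).
  assert (HE : forall U : car (O (scott D)), P U -> exists d, proj1_sig U d /\ E d).
  { intros U PU.
    apply (cpf_lub_iff _ _ _ _ HP (scott_open_lub U)) in PU as [V [[d [Ud ->]] Pd]]. eauto. }
  assert (DE : directed D E).
  { split.
    - destruct (proj1 (proj2 HP)) as [t [_ Pt]]. destruct (HE t Pt) as [d [_ Ed]]. eauto.
    - intros x y Ex Ey.
      destruct (clat_glb _ HO (pair2 _ (way_above x) (way_above y))) as [m Hm].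
      destruct (HE m) as [d [md Ed]]; [apply (cpf_meet_iff _ _ _ _ _ HP Hm); auto|].
      apply (O_meet_iff _ scott_topology _ _ _ d Hm) in md as [H1 H2].
      exists d. split; [exact Ed|]. split; apply (proj2 (HC d)); assumption. }
  destruct (proj2 HD E DE) as [x Hx].
  exists x. split.
  - intros U. split.
    + intros PU. destruct (HE U PU) as [d [Ud Ed]].
      apply (proj1 (proj2_sig U)) with d; [apply Hx, Ed|exact Ud].
    + intros Ux. destruct (proj2 (proj2_sig U) E x DE Hx Ux) as [d [Ed Ud]].
      apply (proj1 HP) with (way_above d); [|exact Ed].
      intros y. apply scott_way_below_sub; [exact (proj2_sig U)|exact Ud].
  - intros y Hy. apply (proj1 HD).
    + apply Hx. intros d Ed. apply (proj2 (HC y)). apply (proj1 (Hy (way_above d)) Ed).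
    + apply (proj2 (HC y)). intros d Hd. apply Hx. exact (proj2 (Hy (way_above d)) Hd).
Qed.

(** Principal upper sets serve as compact neighbourhoods: a single open set containing [d] already
    covers the upper set of [d]. *)
Lemma scott_locally_compact : locally_compact (scott D).
Proof.
  intros x U OU Ux. destruct (scott_open_way_below U x OU Ux) as [d [Ud Hdx]].
  exists (le d), (way_below D d). split; [|split; [|split; [|split; [|split]]]].
  - intros F HF Hcov. destruct (Hcov d) as [V [FV Vd]]; [apply (proj1 HD)|].
    exists (V :: nil). split; [intros W [<- | []]; exact FV|].
    intros y Hy. exists V. split; [left; reflexivity|]. exact (proj1 (HF V FV) d y Hy Vd).
  - intros y Hy. apply (proj2 (HC d)). intros c Hc.
    apply (proj2 (HC y)). apply (Hy _ (way_below_upset_open c)).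
    intros z Hdz. exact (proj1 (way_below_upset_open c) d z Hdz Hc).
  - apply way_below_upset_open.
  - exact Hdx.
  - intros y Hy. apply (proj2 (HC y)), Hy.
  - intros y Hy. exact (proj1 OU d y Hy Ud).
Qed.

(** For [x] in [m], take [d] in [m] way below [x]. Picking from each [S i] a member containing [d]
    gives a choice [f] whose values all include [way_above d], an open neighbourhood of [x]. *)
Lemma O_scott_completely_distributive : is_completely_distributive (O (scott D)).
Proof.
  intros J S a m Ha Hm. pose proof (O_complete_lattice _ scott_topology) as HO. split.
  - intros V [f [Hf HV]]. apply Hm. intros W [i ->].
    apply (clat_trans _ HO) with (f i); [apply HV; eauto|]. apply Ha, Hf.
  - intros Z HZ x mx.
    destruct (scott_open_way_below _ x (proj2_sig m) mx) as [d [md Hd]].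
    destruct (boolp.choice (P := fun i V => S i V /\ proj1_sig V d)) as [f Hf].
    { intros i. apply (O_lub_iff _ scott_topology _ _ d (Ha i)).
      refine (proj1 Hm (a i) _ d md). eauto. }
    destruct (clat_glb _ HO (fun z => exists i, z = f i)) as [V HV].
    refine (HZ V _ x _).
    + exists f. split; [apply Hf|exact HV].
    + apply (proj2 HV (way_above d)); [|exact Hd].
      intros W [i ->] y. apply scott_way_below_sub; [exact (proj2_sig (f i))|apply Hf].
Qed.

End Scott.

Lemma domain_complete_LCS_complete (X : Space) : domain_complete X -> LCS_complete X.
Proof.
  intros [D [HD [HC HG]]]. exists (scott D).
  split; [apply scott_topology|]. split; [apply scott_sober; assumption|].
  split; [apply scott_locally_compact; assumption|exact HG].
Qed.

(** * Completely distributive lattices and their points *)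

Section CompletelyDistributive.
Variable L : Poset.
Hypotheses (HL : is_complete_lattice L) (HCD : is_completely_distributive L).

(** Complete distributivity over the index type [bool], for the families {[x]} and {[y], [z]}, gives
    one inequality; the other holds in every lattice. *)
Lemma completely_distributive_distributive : is_distributive L.
Proof.
  intros x y z yz m xy xz k Hyz Hm Hxy Hxz Hk. apply HL.
  - refine (proj2 (HCD bool (fun b => if b then eq x else pair2 L y z)
      (fun b => if b then x else yz) m _ _) k _).
    + intros [|]; [|exact Hyz]. split; [intros u <-; apply clat_refl, HL|].
      intros u Hu. apply Hu. reflexivity.
    + eapply glb_ext; [|exact Hm]. intros u. split.
      * intros [-> | ->]; [exists true|exists false]; reflexivity.
      * intros [[|] ->]; [left|right]; reflexivity.
    + intros u [f [Hf Hu]]. pose proof (Hf true) as Ht. pose proof (Hf false) as Hff.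
      simpl in Ht, Hff.
      assert (Hux : le u x) by (apply Hu; exists true; exact Ht).
      assert (Huf : le u (f false)) by (apply Hu; exists false; reflexivity).
      destruct Hff as [E | E]; rewrite E in Huf.
      * apply (clat_trans L HL) with xy; [|apply Hk; left; reflexivity].
        apply Hxy. intros w [-> | ->]; assumption.
      * apply (clat_trans L HL) with xz; [|apply Hk; right; reflexivity].
        apply Hxz. intros w [-> | ->]; assumption.
  - apply Hk. intros w [-> | ->]; apply Hm; intros w' [-> | ->].
    + apply Hxy. left. reflexivity.
    + apply (clat_trans L HL) with y; [apply Hxy; right|apply Hyz; left]; reflexivity.
    + apply Hxz. left. reflexivity.
    + apply (clat_trans L HL) with z; [apply Hxz; right|apply Hyz; right]; reflexivity.
Qed.

Definition totally_below (x y : car L) :=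
  forall S s, is_lub L S s -> le y s -> exists z, S z /\ le x z.

(** Complete distributivity is applied to the family of all sets whose join lies above [y]: the meet
    of the joins is [y], and the meet of the values of any choice function is totally below [y]. *)
Lemma totally_below_lub (y : car L) : is_lub L (fun x => totally_below x y) y.
Proof.
  set (J := {Ss : (car L -> Prop) * car L | is_lub L (fst Ss) (snd Ss) /\ le y (snd Ss)}).
  pose proof (HCD J (fun i => fst (proj1_sig i)) (fun i => snd (proj1_sig i)) y) as H.
  destruct H as [_ H2].
  - intros i. apply (proj2_sig i).
  - split.
    + intros z [i ->]. apply (proj2_sig i).
    + intros z Hz. apply Hz.
      (* The singleton of [y] belongs to the family, so the meet of the joins is at most [y]. *)
      assert (Hy : is_lub L (eq y) y /\ le y y).
      { repeat split; [intros u <-; apply clat_refl, HL| |apply clat_refl, HL].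
        intros u Hu. apply Hu. reflexivity. }
      exists (exist _ (eq y, y) Hy). reflexivity.
  - split.
    + intros x Hx. destruct (Hx (eq y) y) as [z [<- Hz]]; auto using clat_refl.
      split; [intros u <-; apply clat_refl, HL|]. intros u Hu. apply Hu. reflexivity.
    + intros z Hz. apply H2. intros x [f [Hf Hx]]. apply Hz.
      intros S s Hs Hys. set (i := exist _ (S, s) (conj Hs Hys) : J).
      exists (f i). split; [apply (Hf i)|]. apply Hx. eauto.
Qed.

Lemma totally_below_le (x y : car L) : totally_below x y -> le x y.
Proof. apply (totally_below_lub y). Qed.

(** The argument for the way-below relation, with arbitrary joins in place of directed ones. *)
Lemma totally_below_interpolation (x y : car L) :
  totally_below x y -> exists m, totally_below x m /\ totally_below m y.
Proof.
  intros Hxy.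
  destruct (Hxy (fun a => exists b, totally_below a b /\ totally_below b y) y)
    as [d [[b [Hdb Hby]] Hxd]].
  - split.
    + intros a [b [Hab Hby]].
      apply (clat_trans L HL) with b; apply totally_below_le; assumption.
    + intros z Hz. apply (totally_below_lub y). intros b Hb.
      apply (totally_below_lub b). intros a Ha. apply Hz. eauto.
  - apply clat_refl, HL.
  - exists b. split; [|exact Hby]. intros S s Hs Hbs.
    destruct (Hdb S s Hs Hbs) as [z [Sz Hz]]. exists z. split; [exact Sz|].
    eapply clat_trans; eauto.
Qed.

(* The up-closure of a chain descending from [u] for the totally-below relation
   and staying above [w] is itself completely prime. *)
Lemma totally_below_cpf (w u : car L) : totally_below w u ->
  exists H, is_cpf L H /\ H u /\ forall x, H x -> le w x.
Proof.
  intros Hwu.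
  destruct (interpolating_chain _ _ totally_below_interpolation w u Hwu) as [s [Hs0 Hs]].
  assert (Hle : forall n, le (s (S n)) (s n)) by (intros n; apply totally_below_le, Hs).
  exists (fun x => exists n, le (s n) x). split; [split; [|split; [|split]]|split].
  - intros x y Hxy [n Hn]. exists n. eapply clat_trans; eauto.
  - destruct (clat_top L HL) as [t Ht]. exists t. split; [exact Ht|]. exists 0. apply Ht.
  - apply chain_filter_meet; assumption.
  - intros S t Ht [n Hn]. destruct (proj2 (Hs n) S t Ht Hn) as [z [Sz Hz]]. eauto.
  - exists 0. rewrite Hs0. apply clat_refl, HL.
  - intros x [n Hn]. apply (clat_trans L HL) with (s n); [|exact Hn].
    apply totally_below_le, Hs.
Qed.

Definition cpf_poset : Poset :=
  {| car := pts (pt L);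
     le := fun p q => forall u, proj1_sig p u -> proj1_sig q u |}.

Lemma cpf_directed_union (E : car cpf_poset -> Prop) : directed cpf_poset E ->
  is_cpf L (fun u => exists p, E p /\ proj1_sig p u).
Proof.
  intros [[p0 Ep0] HE]. split; [|split; [|split]].
  - intros x y Hxy [p [Ep px]]. exists p. split; [exact Ep|].
    exact (proj1 (proj2_sig p) x y Hxy px).
  - destruct (clat_top L HL) as [t Ht]. exists t. split; [exact Ht|].
    exists p0. split; [exact Ep0|]. exact (cpf_top L _ t (proj2_sig p0) Ht).
  - intros x y m Hm [p [Ep px]] [q [Eq qy]].
    destruct (HE p q Ep Eq) as [r [Er [Hpr Hqr]]]. exists r. split; [exact Er|].
    apply (cpf_meet_iff L _ _ _ _ (proj2_sig r) Hm). split; [apply Hpr, px|apply Hqr, qy].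
  - intros S s Hs [p [Ep ps]].
    apply (cpf_lub_iff L _ _ _ (proj2_sig p) Hs) in ps as [x [Sx px]]. eauto.
Qed.

Lemma cpf_directed_lub_iff (E : car cpf_poset -> Prop) (s : car cpf_poset) (u : car L) :
  directed cpf_poset E -> is_lub cpf_poset E s ->
  (proj1_sig s u <-> exists p, E p /\ proj1_sig p u).
Proof.
  intros HE [H1 H2]. split.
  - intros su. apply (H2 (exist _ _ (cpf_directed_union E HE))); [|exact su].
    intros p Ep v pv. exists p. auto.
  - intros [p [Ep pu]]. exact (H1 p Ep u pu).
Qed.

Lemma cpf_poset_dcpo : is_dcpo cpf_poset.
Proof.
  split; [split; [|split]|].
  - intros p u pu. exact pu.
  - intros p q r Hpq Hqr u pu. apply Hqr, Hpq, pu.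
  - intros p q Hpq Hqp. apply sig_ext, pred_ext. intros u. split; [apply Hpq|apply Hqp].
  - intros E HE. exists (exist _ _ (cpf_directed_union E HE)). split.
    + intros p Ep u pu. exists p. auto.
    + intros q Hq u [p [Ep pu]]. exact (Hq p Ep u pu).
Qed.

(** An explicit form of approximation, witnessed by an element of [L]; it implies the way-below
    relation and is cofinal in it. *)
Definition cpf_approximates (h p : car cpf_poset) :=
  exists w, proj1_sig p w /\ forall x, proj1_sig h x -> le w x.

(** As [u] is the join of the elements totally below it, [p] contains one of them, [w]; the filter
    generated by a chain between [w] and [u] is the required [h]. *)
Lemma cpf_approximates_exists (p : car cpf_poset) (u : car L) :
  proj1_sig p u -> exists h, cpf_approximates h p /\ proj1_sig h u.
Proof.
  intros pu.
  apply (cpf_lub_iff L _ _ _ (proj2_sig p) (totally_below_lub u)) in pu as [w [Hwu pw]].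
  destruct (totally_below_cpf w u Hwu) as [H [HH [Hu Hw]]].
  exists (exist _ H HH). split; [|exact Hu]. exists w. auto.
Qed.

Lemma cpf_approximates_directed (p : car cpf_poset) :
  directed cpf_poset (fun h => cpf_approximates h p).
Proof.
  split.
  - destruct (clat_top L HL) as [t Ht].
    destruct (cpf_approximates_exists p t (cpf_top L _ t (proj2_sig p) Ht)) as [h [Hh _]].
    eauto.
  - intros h1 h2 [w1 [pw1 H1]] [w2 [pw2 H2]].
    (* An approximation containing the meet [m] of both witnesses includes [h1] and [h2], as all
       their members lie above [m]. *)
    destruct (clat_glb L HL (pair2 L w1 w2)) as [m Hm].
    destruct (cpf_approximates_exists p m) as [h [Hh hm]].
    { apply (cpf_meet_iff L _ _ _ _ (proj2_sig p) Hm). auto. }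
    exists h. split; [exact Hh|].
    split; intros u hu; apply (proj1 (proj2_sig h)) with m; try exact hm.
    + apply (clat_trans L HL) with w1; [apply Hm; left; reflexivity|auto].
    + apply (clat_trans L HL) with w2; [apply Hm; right; reflexivity|auto].
Qed.

Lemma cpf_approximates_lub (p : car cpf_poset) :
  is_lub cpf_poset (fun h => cpf_approximates h p) p.
Proof.
  split.
  - intros h [w [pw Hw]] u hu. exact (proj1 (proj2_sig p) w u (Hw u hu) pw).
  - intros q Hq u pu. destruct (cpf_approximates_exists p u pu) as [h [Hh hu]].
    exact (Hq h Hh u hu).
Qed.

Lemma cpf_approximates_way_below (h p : car cpf_poset) :
  cpf_approximates h p -> way_below cpf_poset h p.
Proof.
  intros [w [pw Hw]] E s HE Hs Hps.
  apply Hps, (cpf_directed_lub_iff E s w HE Hs) in pw as [q [Eq qw]].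
  exists q. split; [exact Eq|]. intros u hu. exact (proj1 (proj2_sig q) w u (Hw u hu) qw).
Qed.

Lemma cpf_poset_continuous : is_continuous cpf_poset.
Proof.
  intros p.
  pose proof (cpf_approximates_directed p) as HB. pose proof (cpf_approximates_lub p) as Hp.
  assert (Hwb : forall q, way_below cpf_poset q p ->
    exists h, cpf_approximates h p /\ le q h).
  { intros q Hq. apply (Hq _ p HB Hp). intros u pu. exact pu. }
  split; [split|split].
  - destruct (proj1 HB) as [h Hh]. exists h. apply cpf_approximates_way_below, Hh.
  - intros q r Hq Hr. destruct (Hwb q Hq) as [h1 [H1 Hq1]].
    destruct (Hwb r Hr) as [h2 [H2 Hr2]].
    destruct (proj2 HB h1 h2 H1 H2) as [h [Hh [Hh1 Hh2]]].
    exists h. split; [apply cpf_approximates_way_below, Hh|].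
    split; intros u Hu; [apply Hh1, Hq1, Hu|apply Hh2, Hr2, Hu].
  - intros q Hq u qu. destruct (Hwb q Hq) as [h [Hh Hqh]].
    exact (proj1 Hp h Hh u (Hqh u qu)).
  - intros z Hz. apply Hp. intros h Hh. apply Hz, cpf_approximates_way_below, Hh.
Qed.

(** A Scott-open [V] is named by the join of all [w] whose basic open set lies in [V]: for [p] in
    [V], some approximation [h] of [p] is in [V], and every point containing its witness [w]
    includes [h]. *)
Lemma scott_cpf_poset : scott cpf_poset = pt L.
Proof.
  unfold scott, pt. simpl. f_equal. apply pred_ext. intros V. split.
  - intros [HVup HVdir].
    destruct (proj2 HL (fun w => forall p : pts (pt L), proj1_sig p w -> V p)) as [j Hj].
    exists j. intros p. rewrite (cpf_lub_iff L _ _ _ (proj2_sig p) Hj). split.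
    + intros Vp.
      destruct (HVdir _ p (cpf_approximates_directed p) (cpf_approximates_lub p) Vp)
        as [h [[w [pw Hw]] Vh]].
      exists w. split; [|exact pw]. intros q qw. apply HVup with h; [|exact Vh].
      intros u hu. exact (proj1 (proj2_sig q) w u (Hw u hu) qw).
    + intros [w [Hw pw]]. auto.
  - intros [u Hu]. split.
    + intros p q Hpq Vp. apply Hu, Hpq, Hu, Vp.
    + intros E s HE Hs Vs. apply Hu, (cpf_directed_lub_iff E s u HE Hs) in Vs as [p [Ep pu]].
      exists p. split; [exact Ep|]. apply Hu, pu.
Qed.

End CompletelyDistributive.

Lemma pt_quot_domain_complete (L : Poset) (A : car L -> Prop) :
  cd_cont_clat L -> countable L A -> domain_complete (pt (quot L A)).
Proof.
  intros [HL [HCD _]] HA. exists (cpf_poset L).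
  split; [apply cpf_poset_dcpo, HL|].
  split; [apply cpf_poset_continuous; assumption|].
  rewrite scott_cpf_poset by assumption.
  exists (points_containing L A). split.
  - apply points_containing_G_delta; assumption.
  - apply pt_quot_homeomorphic, HL.
Qed.

(** * The two equivalences *)

Lemma LCS_complete_unit_iso (X : Space) : is_topology X -> LCS_complete X -> unit_iso X.
Proof.
  intros HX [Y [HY [Hs [_ [G [HG Hh]]]]]].
  destruct (homeomorphic_subspace_embeds X Y G HX Hh) as [f Hf].
  apply sober_unit_iso; [exact HX|].
  apply (G_delta_embedding_sober X Y f G); assumption.
Qed.

Lemma LCS_complete_frame_iso (X : Space) : is_topology X -> LCS_complete X ->
  exists (L : Poset) (A : car L -> Prop),
    dist_cont_clat L /\ countable L A /\ frame_iso (O X) (quot L A).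
Proof.
  intros HX [Y [HY [Hs [Hlc [G [HG Hh]]]]]].
  destruct (homeomorphic_subspace_embeds X Y G HX Hh) as [f Hf].
  destruct (G_delta_embedding_frame_iso X Y f G HY Hs HG Hf Hlc) as [A [HA Hiso]].
  exists (O Y), A. split; [|auto].
  split; [apply O_complete_lattice, HY|].
  split; [apply O_distributive, HY|apply O_continuous; assumption].
Qed.

Lemma domain_complete_frame_iso (X : Space) : is_topology X -> domain_complete X ->
  exists (L : Poset) (A : car L -> Prop),
    cd_cont_clat L /\ countable L A /\ frame_iso (O X) (quot L A).
Proof.
  intros HX [D [HD [HC [G [HG Hh]]]]].
  pose proof (scott_topology D) as HY.
  pose proof (scott_locally_compact D HD HC) as Hlc.
  destruct (homeomorphic_subspace_embeds X _ G HX Hh) as [f Hf].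
  destruct (G_delta_embedding_frame_iso X _ f G HY (scott_sober D HD HC) HG Hf Hlc)
    as [A [HA Hiso]].
  exists (O (scott D)), A. split; [|auto].
  split; [apply O_complete_lattice, HY|].
  split; [apply O_scott_completely_distributive; assumption|apply O_continuous; assumption].
Qed.

(** An adjunction restricts to an adjoint equivalence once both functors land in the chosen classes,
    up to isomorphism, and the unit and counit components there are isomorphisms; these are the four
    clauses of each half. *)
Theorem theorem11p1 :
  (* LCS-complete spaces  <->  quotients of distributive continuous complete lattices *)
  ((forall X : Space, is_topology X -> LCS_complete X ->
      exists (L : Poset) (A : car L -> Prop),
        dist_cont_clat L /\ countable L A /\ frame_iso (O X) (quot L A)) /\
   (forall (L : Poset) (A : car L -> Prop), dist_cont_clat L -> countable L A ->
      LCS_complete (pt (quot L A))) /\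
   (forall X : Space, is_topology X -> LCS_complete X -> unit_iso X) /\
   (forall (L : Poset) (A : car L -> Prop), dist_cont_clat L -> countable L A ->
      counit_iso (quot L A)))
  /\
  (* domain-complete spaces  <->  quotients of continuous completely distributive lattices *)
  ((forall X : Space, is_topology X -> domain_complete X ->
      exists (L : Poset) (A : car L -> Prop),
        cd_cont_clat L /\ countable L A /\ frame_iso (O X) (quot L A)) /\
   (forall (L : Poset) (A : car L -> Prop), cd_cont_clat L -> countable L A ->
      domain_complete (pt (quot L A))) /\
   (forall X : Space, is_topology X -> domain_complete X -> unit_iso X) /\
   (forall (L : Poset) (A : car L -> Prop), cd_cont_clat L -> countable L A ->
      counit_iso (quot L A))).
Proof.
  assert (Hcd : forall L, cd_cont_clat L -> dist_cont_clat L).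
  { intros L [HL [HCD HC]]. split; [exact HL|].
    split; [apply completely_distributive_distributive; assumption|exact HC]. }
  split; (split; [|split; [|split]]).
  - exact LCS_complete_frame_iso.
  - exact pt_quot_LCS_complete.
  - exact LCS_complete_unit_iso.
  - exact quot_counit_iso.
  - exact domain_complete_frame_iso.
  - exact pt_quot_domain_complete.
  - intros X HX HD. apply LCS_complete_unit_iso, domain_complete_LCS_complete; assumption.
  - intros L A HL. apply quot_counit_iso, Hcd, HL.
Qed.
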